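(* Let $K$ be a number field such that $K/\mathbb{Q}$ is Galois. Let $\mathcal{S}=\{x\in\mathcal{O}_K : |\mathrm{Nm}_{K/\mathbb{Q}}(x)|\ge 2\}=\mathcal{O}_K\setminus(\mathcal{O}_K^*\cup\{0\})$ and $\eta_K=\min_{x\in\mathcal{S}}|\mathrm{Nm}_{K/\mathbb{Q}}(x)|$. If $\gamma_K<\eta_K^{2/[K:\mathbb{Q}]}\,[K:\mathbb{Q}]$, where $\gamma_K$ is the Hermite-Humbert constant of $K$, then $K$ is strongly unit reducible.
   Context: $K$ is a Galois extension of $\mathbb{Q}$ of degree $n=[K:\mathbb{Q}]$ (hence totally real or totally complex), with embeddings $\sigma_1,\dots,\sigma_n$ into $\mathbb{C}$ (into $\mathbb{R}$ if $K$ is totally real). $\mathcal{O}_K$ is its ring of integers and $\mathcal{O}_K^*$ its unit group. The symbol $*$ denotes complex conjugation if $K$ is totally complex and the identity if $K$ is totally real. An element $a\in K$ is totally positive if $\sigma_i(a)\in\mathbb{R}_{>0}$ for all $i$; $K_{>>0}$ is the set of totally positive elements. For $a\in K_{>>0}$ and $x\in K$, $\mathrm{Tr}_{K/\mathbb{Q}}(axx^* )$ is understood as $\sum_{i=1}^n\sigma_i(a)\sigma_i(x)\sigma_i(x)^*=\sum_{i=1}^n\sigma_i(a)|\sigma_i(x)|^2$. For $a\in K_{>>0}$ define $\mu(a)=\min_{x\in\mathcal{O}_K\setminus\{0\}}\mathrm{Tr}_{K/\mathbb{Q}}(axx^* )$, $\mu^*(a)=\min_{u\in\mathcal{O}_K^*}\mathrm{Tr}_{K/\mathbb{Q}}(auu^*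 )$, $\mathcal{M}(a)=\{x\in\mathcal{O}_K:\mathrm{Tr}_{K/\mathbb{Q}}(axx^* )=\mu(a)\}$. $K$ is unit reducible if $\mu(a)=\mu^*(a)$ for all $a\in K_{>>0}$. A unit reducible field $K$ is strongly unit reducible if $\mathcal{M}(a)\subset\mathcal{O}_K^*$ for all $a\in K_{>>0}$. The Hermite-Humbert constant of $K$ is $\gamma_K=\sup_{a\in K_{>>0}}\mu(a)/\mathrm{Nm}_{K/\mathbb{Q}}(a)^{1/n}$. *)

(* Defs.v *)
From HB Require Import structures.
From mathcomp Require Import all_boot all_order all_algebra.
From mathcomp Require Import all_classical all_reals all_analysis.
From mathcomp Require Import vector falgebra fieldext galois complex.

Set Implicit Arguments.
Unset Strict Implicit.
Unset Printing Implicit Defensive.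

Import Order.TTheory GRing.Theory Num.Theory.

Local Open Scope classical_set_scope.
Local Open Scope ring_scope.

(* Least element of A; the default x0 is returned when A has none. *)
Definition set_min (d : Order.disp_t) (T : porderType d) (x0 : T) (A : set T) : T :=
  xget x0 [set m | A m /\ lbound A m].

Definition ring_of_integers (K : splittingFieldType rat) : set K :=
  [set x | integralOver (intr : int -> K) x].

Definition integer_units (K : splittingFieldType rat) : set K :=
  [set u | ring_of_integers u /\
           exists2 v, ring_of_integers v & u * v = 1].

(* The library norm galNorm takes its values in the line 1%VS = Q.1 of K;
   its coordinate on 1 is the norm as a rational number. *)
Definition Nm (K : splittingFieldType rat) (x : K) : rat :=
  coord [tuple (1 : K)] ord0 (galNorm 1%VS {:K} x).

Definition nonunit_integers (K : splittingFieldType rat) : set K :=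
  [set x | ring_of_integers x /\ 2 <= `|Nm x|].

Definition etaK (K : splittingFieldType rat) : rat :=
  set_min 0 [set `|Nm x| | x in @nonunit_integers K].

Section Embeddings.
Variables (R : realType) (K : splittingFieldType rat).
Variable sigma : 'I_(\dim {:K}) -> {rmorphism K -> R[i]}.

Definition enumerates_embeddings : Prop :=
  (forall i j, sigma i =1 sigma j -> i = j) /\
  (forall f : {rmorphism K -> R[i]}, exists i, f =1 sigma i).

(* The order of R[i] satisfies 0 < z iff z is real and positive. *)
Definition totally_positive : set K := [set a | forall i, 0 < sigma i a].

(* Tr(a x x^* ).  Complex conjugation is trivial on the image of sigma i when K
   is totally real, so one formula covers the totally real and totally complex
   cases.  The sum is real when a is totally positive; Re only casts it to R. *)
Definition trace_form (a x : K) : R :=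
  complex.Re (\sum_i sigma i a * sigma i x * Num.conj (sigma i x)).

Definition mu (a : K) : R :=
  set_min 0 [set trace_form a x | x in @ring_of_integers K `\ 0].

Definition mu_star (a : K) : R :=
  set_min 0 [set trace_form a u | u in @integer_units K].

Definition min_vectors (a : K) : set K :=
  [set x | ring_of_integers x /\ trace_form a x = mu a].

Definition unit_reducible : Prop :=
  forall a, totally_positive a -> mu a = mu_star a.

Definition strongly_unit_reducible : Prop :=
  unit_reducible /\
  forall a, totally_positive a -> min_vectors a `<=` @integer_units K.

(* The supremum is taken in the extended reals, so it is meaningful without a
   prior proof that the set is bounded. *)
Definition hermite_humbert : \bar R :=
  ereal_sup [set (mu a / (ratr (Nm a) `^ (\dim {:K})%:R^-1))%:E
            | a in totally_positive].

End Embeddings.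

(* Main.v *)
(* By AM-GM, Tr(a x x^* ) >= n (Nm(a) Nm(x)^2)^(1/n).  For an integer x that is
   neither 0 nor a unit, |Nm(x)| >= eta_K, so the right-hand side is at least
   n eta_K^(2/n) Nm(a)^(1/n) > gamma_K Nm(a)^(1/n) >= mu(a), and x is not minimal.
   That mu(a) is attained, hence positive, needs the finiteness of the set of
   integers x with bounded trace form.  On it the integers Nm(k - x), 0 <= k <= n,
   are bounded, and together they determine prod_g (X - g x), that is, x up to
   Galois conjugation. *)
Require Import Defs.
From HB Require Import structures.
From mathcomp Require Import all_boot all_order all_algebra.
From mathcomp Require Import all_classical all_reals all_analysis.
From mathcomp Require Import vector falgebra fieldext galois complex.
From mathcomp Require Import algC algnum lra.

Set Implicit Arguments.
Unset Strict Implicit.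
Unset Printing Implicit Defensive.

Import Order.TTheory GRing.Theory Num.Theory.

Local Open Scope classical_set_scope.
Local Open Scope ring_scope.

(** * Least elements of sets, and rational algebraic integers *)

Lemma set_minE (d : Order.disp_t) (T : porderType d) (x0 m : T) (A : set T) :
  A m -> lbound A m -> set_min x0 A = m.
Proof.
move=> Am lbm; apply: xget_subset1 => // x y [Ax lbx] [Ay lby].
by apply/eqP; rewrite eq_le lbx ?lby.
Qed.

Lemma finite_set_argmin (R : realDomainType) (T : choiceType) (f : T -> R) (A : set T) :
  finite_set A -> A !=set0 -> exists2 x, A x & forall y, A y -> f x <= f y.
Proof.
move=> /finite_seqP[s ->] [x0 /= x0s].
have i0P : (index x0 s < size s)%N by rewrite index_mem.
pose F (i : 'I_(size s)) := f (nth x0 s i).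
case: (@Order.TotalTheory.arg_minP _ R _ (Ordinal i0P) xpredT F) => // i _ i_min.
exists (nth x0 s i) => [|y /= ys]; first exact: mem_nth.
have yP : (index y s < size s)%N by rewrite index_mem.
by have := i_min (Ordinal yP) isT; rewrite /F /= nth_index.
Qed.

(** The question is moved to [algC], where a root of a monic integer polynomial lies in [Aint] and a
    rational member of [Aint] is an integer. *)
Lemma integral_rat_int (q : rat) :
  integralOver (intr : int -> rat) q -> q \is a Num.int.
Proof.
case=> p p_monic pq0.
have ratrZ : (ratr \o intr : int -> algC) =1 intr by move=> z; rewrite /= ratr_int.
have : (ratr q : algC) \in Aint.
  apply: (@root_monic_Aint (map_poly intr p)).
  - by rewrite -(eq_map_poly ratrZ) (map_poly_comp (ratr : rat -> algC)) fmorph_root.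
  - exact: monic_map.
  - by apply/polyOverP => i; rewrite coef_map /= rpred_int.
move=> /(Cint_rat_Aint (Crat_rat q)) /intrP[m].
rewrite -[m%:~R](ratr_int algC) => /fmorph_inj ->.
exact: rpred_int.
Qed.

(** * The Galois norm: integrality, units and the minimum [etaK] *)

Section GaloisNorm.
Variable K : splittingFieldType rat.
Hypothesis hK : galois 1%VS {:K}.

Local Notation OK := (@ring_of_integers K).
Local Notation n := (\dim {:K}).

Lemma mem_gal1 (g : gal_of {:K}) : g \in 'Gal({:K} / 1)%g.
Proof. by rewrite (gal_kHom _ (sub1v _)) k1HomE ahomWin. Qed.

Lemma gal_fullv_id (x : K) : (1%g : gal_of {:K}) x = x.
Proof. exact: (gal_id {:K}%AS). Qed.

Lemma card_gal1 : #|{: gal_of {:K}}| = \dim {:K}.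
Proof.
have /= := galois_dim hK; rewrite dimv1 divn1 => ->.
by apply: eq_card => g; rewrite mem_gal1.
Qed.

Lemma dimK_gt0 : (0 < \dim {:K})%N.
Proof. exact: adim_gt0. Qed.

Lemma galNormE (x : K) : galNorm 1%VS {:K} x = \prod_(g : gal_of {:K}) g x.
Proof. by apply: eq_bigl => g; rewrite mem_gal1. Qed.

(** The Galois norm lies in the line spanned by 1, so its coordinate there loses nothing. *)
Lemma Nm_alg (x : K) : (Nm x)%:A = galNorm 1%VS {:K} x.
Proof.
have /vlineP[q Nq] := mem_galNorm hK (memvf x).
rewrite /Nm Nq linearZ /= (coord_free ord0 ord0 (X := [tuple (1 : K)])) ?eqxx ?mulr1 //.
by rewrite seq1_free oner_neq0.
Qed.

Lemma Nm_neq0 (x : K) : x != 0 -> Nm x != 0.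
Proof.
apply: contra_neq => N0; apply/eqP.
by rewrite -(galNorm_eq0 1%VS {:K}) -Nm_alg N0 scale0r.
Qed.

Lemma ring_of_integers_gal (g : gal_of {:K}) x : OK x -> OK (g x).
Proof.
move=> Ox; rewrite /ring_of_integers /=.
have -> : intr = g \o intr :> (int -> K) by apply/funext => z; rewrite /= rmorph_int.
exact: integral_rmorph.
Qed.

Lemma ring_of_integers_prod (I : finType) (P : pred I) (F : I -> K) :
  (forall i, OK (F i)) -> OK (\prod_(i | P i) F i).
Proof.
move=> OF; elim/big_rec: _ => [|i x _ Ox]; first exact: integral1.
exact: (integral_mul (RtoK := intr) (OF i) Ox).
Qed.

Lemma ring_of_integers_Nm x : OK x -> OK (Nm x)%:A.
Proof.
move=> Ox; rewrite Nm_alg galNormE; apply: ring_of_integers_prod => g.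
exact: ring_of_integers_gal.
Qed.

(** A monic integer equation for the norm in [K] pulls back to the rationals, since [in_alg] is
    injective. *)
Lemma Nm_int x : OK x -> Nm x \is a Num.int.
Proof.
move=> /ring_of_integers_Nm[p p_monic pN]; apply: integral_rat_int; exists p => //.
rewrite -(fmorph_root (GRing.in_alg K)) -map_poly_comp.
by rewrite (eq_map_poly (g := intr)) // => z; rewrite /= -in_algE rmorph_int.
Qed.

(** The inverse is the norm times the product of the nontrivial conjugates: multiplying it by [x]
    gives the square of the norm, which is 1. *)
Lemma norm1_unit x : OK x -> `|Nm x| = 1 -> integer_units x.
Proof.
move=> Ox N1; split=> //.
exists ((Nm x)%:A * \prod_(g : gal_of {:K} | g != 1%g) g x).
  apply: (integral_mul (RtoK := intr)); first exact: ring_of_integers_Nm.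
  by apply: ring_of_integers_prod => g; apply: ring_of_integers_gal.
have xE : x * \prod_(g : gal_of {:K} | g != 1%g) g x = (Nm x)%:A.
  by rewrite Nm_alg galNormE [RHS](bigD1 (1%g : gal_of {:K})) //= gal_fullv_id.
rewrite mulrCA xE -!in_algE -rmorphM -expr2.
by rewrite -real_normK ?num_real // N1 expr1n rmorph1.
Qed.

Lemma integer_unit_or_nonunit x : OK x -> x != 0 ->
  integer_units x \/ nonunit_integers x.
Proof.
move=> Ox x0; have /natrP[m Nm_m] := natr_norm_int (Nm_int Ox).
have : `|Nm x| != 0 by rewrite normr_eq0 Nm_neq0.
case: m Nm_m => [|[|m]] Nm_m; rewrite Nm_m ?eqxx // => _.
- by left; apply: norm1_unit.
- by right; split; rewrite // Nm_m ler_nat.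
Qed.

(** Norms of integers have natural absolute values, so well-ordering gives a least one; [x]
    witnesses that there is one to choose from, hence [set_min] does not fall back on its
    default. *)
Lemma etaK_le (x : K) : nonunit_integers x -> 0 <= etaK K <= `|Nm x|.
Proof.
move=> Sx.
pose P m := `[< exists2 y : K, nonunit_integers y & `|Nm y| = m%:R >].
have PN (y : K) : nonunit_integers y -> exists2 m, P m & `|Nm y| = m%:R.
  move=> Sy; have /natrP[m Nm_m] := natr_norm_int (Nm_int (proj1 Sy)).
  by exists m => //; apply/asboolP; exists y.
have exP : exists m, P m by have [m Pm _] := PN x Sx; exists m.
case: (ex_minnP exP) => m /asboolP[y Sy Ny] m_min.
rewrite /etaK (@set_minE _ _ _ m%:R).
- have [k Pk ->] := PN x Sx.
  by rewrite ler0n ler_nat m_min.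
- by exists y.
- by move=> _ [z Sz <-]; have [k Pk ->] := PN z Sz; rewrite ler_nat m_min.
Qed.

(** * Finiteness of the integers whose translates have bounded norms *)

Definition galPoly (x : K) : {poly K} := \prod_(g : gal_of {:K}) ('X - (g x)%:P).

(** [galPoly x] is the characteristic polynomial of [x] over the rationals, written through its
    roots in [K]; this makes its rational values norms. *)
Lemma horner_galPoly x (q : rat) : (galPoly x).[q%:A] = (Nm (q%:A - x))%:A.
Proof.
rewrite horner_prod Nm_alg galNormE; apply: eq_bigr => g _.
by rewrite hornerXsubC rmorphB /= linearZ /= rmorph1.
Qed.

(** The difference has degree at most [n] and vanishes at the [n.+1] distinct points 0, ..., [n]. *)
Lemma galPoly_inj x y :
  (forall k : 'I_n.+1, Nm (k%:R - x) = Nm (k%:R - y)) -> galPoly x = galPoly y.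
Proof.
move=> eqN; apply/eqP; rewrite -subr_eq0; apply/eqP.
pose rs : seq K := [seq (k : nat)%:R | k : 'I_n.+1 <- enum 'I_n.+1].
have natA k : k%:R = (k%:R : rat)%:A :> K by rewrite -in_algE rmorph_nat.
apply: (@roots_geq_poly_eq0 _ _ rs).
- apply/allP => _ /mapP[k _ ->]; rewrite rootE !hornerE natA !horner_galPoly -natA.
  by rewrite eqN subrr.
- rewrite map_inj_uniq ?enum_uniq // => j k.
  rewrite !natA => /(fmorph_inj (GRing.in_alg K)) /eqP.
  by rewrite eqr_nat => /eqP /val_inj.
- rewrite size_map size_enum_ord (leq_trans (size_polyD _ _)) // size_polyN geq_max.
  by rewrite !size_prod_XsubC -[index_enum _]enumT -cardT card_gal1 leqnn.
Qed.

(** The factor of the identity makes [x] a root of its own polynomial, so some factor of the other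
    one vanishes at [x]. *)
Lemma galPoly_conj x y : galPoly x = galPoly y -> exists g : gal_of {:K}, x = g y.
Proof.
move=> eqxy; have : root (galPoly y) x.
  rewrite -eqxy /galPoly (bigD1 (1%g : gal_of {:K})) //.
  by rewrite rootM gal_fullv_id root_XsubC eqxx.
rewrite rootE horner_prod => /prodf_eq0[g _].
by rewrite hornerXsubC subr_eq0 => /eqP; exists g.
Qed.

Lemma finite_Nm_fiber (v : 'I_n.+1 -> rat) :
  finite_set [set x : K | forall k : 'I_n.+1, Nm (k%:R - x) = v k].
Proof.
set A := [set x | _].
have [->|/set0P[x0 x0v]] := eqVneq A set0; first exact: finite_set0.
apply: (@sub_finite_set _ _ (range (fun g : gal_of {:K} => g x0))).
  move=> x xv; have [|g ->] := @galPoly_conj x x0; last by exists g.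
  by apply: galPoly_inj => k; rewrite xv x0v.
by apply: finite_image; apply: finite_finset.
Qed.

Lemma finite_Nm_bounded (N : nat) :
  finite_set [set x | OK x /\ forall k : 'I_n.+1, `|Nm (k%:R - x)| <= N%:R].
Proof.
(* An integer between -[N] and [N] is coded by its shift by [N], an ordinal below [(N + N).+1]; the
   bounded set is then a finite union of fibers. *)
pose val (t : {ffun 'I_n.+1 -> 'I_(N + N).+1}) (k : 'I_n.+1) : rat := (t k)%:R - N%:R.
pose fiber t := [set x : K | forall k : 'I_n.+1, Nm (k%:R - x) = val t k].
apply: (@sub_finite_set _ _ (\bigcup_(t in setT) fiber t)).
  move=> x [Ox xN]; pose s k := Num.trunc (Nm (k%:R - x) + N%:R).
  exists [ffun k : 'I_n.+1 => inord (s k)] => // k.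
  have Nk : Nm (k%:R - x) \is a Num.int.
    by apply/Nm_int/(integral_sub (RtoK := intr)) => //; apply: (integral_nat intr).
  have : Nm (k%:R - x) + N%:R \is a Num.nat.
    rewrite natrEint rpredD ?rpred_nat //= -lerBlDr sub0r.
    by have := xN k; rewrite ler_norml => /andP[].
  rewrite /val ffunE => /natrP[m mE].
  have sk : s k = m by rewrite /s mE Num.Theory.natrK.
  rewrite inordK sk -?mE ?addrK // ltnS -(ler_nat rat) -mE natrD lerD2r.
  exact: le_trans (ler_norm _) (xN k).
by apply: bigcup_finite => [|t _]; [apply: finite_finset | apply: finite_Nm_fiber].
Qed.

End GaloisNorm.

(** * Complex embeddings and absolute values *)

Section TraceForm.
Variables (R : realType) (K : splittingFieldType rat).
Hypothesis hK : galois 1%VS {:K}.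
Variable sigma : 'I_(\dim {:K}) -> {rmorphism K -> R[i]}.
Hypothesis hsigma : enumerates_embeddings sigma.

Local Notation OK := (@ring_of_integers K).
Local Notation toC := (real_complex R).
Local Notation n := (\dim {:K}).

(** Following one fixed embedding, the automorphisms give pairwise distinct embeddings; as both
    families have [n] members, [tau] reindexes the product over embeddings into the Galois norm. *)
Lemma prod_embeddings x : \prod_i sigma i x = toC (ratr (Nm x)).
Proof.
pose i0 : 'I_n := Ordinal (dimK_gt0 K).
have /choice[tau tauE] : forall g : gal_of {:K}, exists i, sigma i0 \o g =1 sigma i.
  by move=> g; exact: (hsigma.2 (sigma i0 \o g : {rmorphism K -> R[i]})).
have tau_bij : bijective tau.
  apply: inj_card_bij => [g h tau_gh|]; last by rewrite card_ord card_gal1.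
  apply/eqP/(@gal_eqP _ _ {:K}%AS) => x' _; apply: (fmorph_inj (sigma i0)).
  by have := tauE g x'; rewrite tau_gh -tauE.
(* Any ring morphism out of [rat] agrees with [ratr], which identifies the image of the rational
   norm. *)
pose sigmaQ : {rmorphism rat -> R[i]} := sigma i0 \o GRing.in_alg K.
rewrite fmorph_rat -(fmorph_eq_rat sigmaQ) /=.
rewrite Nm_alg // galNormE rmorph_prod (reindex tau) /=; last exact: onW_bij.
by apply: eq_bigr => g _; rewrite -tauE.
Qed.

Definition absval i (x : K) : R := complex.Re `|sigma i x|.

Lemma absvalE i x : `|sigma i x| = toC (absval i x).
Proof. by rewrite /absval RRe_real ?normr_real. Qed.

Lemma absval_ge0 i x : 0 <= absval i x.
Proof. by rewrite -lecR -absvalE normr_ge0. Qed.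

Lemma absval_gt0 i x : x != 0 -> 0 < absval i x.
Proof. by move=> x0; rewrite -ltcR -absvalE normr_gt0 fmorph_eq0. Qed.

Lemma prod_absval x : \prod_i absval i x = `|ratr (Nm x)|.
Proof.
apply: complexI; rewrite rmorph_prod /= (eq_bigr (fun i => `|sigma i x|)) => [|i _].
  by rewrite -normr_prod prod_embeddings normc_def /= expr0n addr0 sqrtr_sqr.
by rewrite absvalE.
Qed.

(** * The trace form of a totally positive element: AM-GM and attained minima *)

Section TotallyPositive.
Variable a : K.
Hypothesis a_pos : totally_positive sigma a.

Definition realval i : R := complex.Re (sigma i a).

Lemma realvalE i : sigma i a = toC (realval i).
Proof. by rewrite /realval RRe_real ?gtr0_real. Qed.

Lemma realval_gt0 i : 0 < realval i.
Proof. by rewrite -ltcR -realvalE. Qed.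

Lemma trace_term_ge0 i x : 0 <= realval i * absval i x ^+ 2.
Proof. exact: mulr_ge0 (ltW (realval_gt0 i)) (sqr_ge0 _). Qed.

Lemma prod_realval : \prod_i realval i = ratr (Nm a).
Proof.
apply: complexI; rewrite -prod_embeddings rmorph_prod.
by apply: eq_bigr => i _; rewrite realvalE.
Qed.

Lemma Nm_totally_positive : 0 < ratr (Nm a) :> R.
Proof. by rewrite -prod_realval prodr_gt0 // => i _; exact: realval_gt0. Qed.

Lemma trace_formE x : trace_form sigma a x = \sum_i realval i * absval i x ^+ 2.
Proof.
apply: complexI; rewrite rmorph_sum /trace_form.
have -> : \sum_i sigma i a * sigma i x * Num.conj (sigma i x) =
          toC (\sum_i realval i * absval i x ^+ 2).
  rewrite rmorph_sum; apply: eq_bigr => i _.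
  by rewrite -mulrA -normCK realvalE absvalE rmorphM rmorphXn.
by rewrite rmorph_sum.
Qed.

Lemma trace_form_gt0 x : x != 0 -> 0 < trace_form sigma a x.
Proof.
move=> x0; rewrite trace_formE (bigD1 (Ordinal (dimK_gt0 K))) //=.
apply: ltr_wpDr; last by rewrite mulr_gt0 ?realval_gt0 ?exprn_gt0 ?absval_gt0.
by apply: sumr_ge0 => i _; exact: trace_term_ge0.
Qed.

Lemma trace_form0 : trace_form sigma a 0 = 0.
Proof.
rewrite trace_formE big1 // => i _.
by rewrite /absval rmorph0 normr0 /= expr0n mulr0.
Qed.

(** AM-GM for the [n] nonnegative terms of [trace_formE], whose product is the left-hand side. *)
Lemma norm_le_trace_form x :
  ratr (Nm a) * ratr (Nm x) ^+ 2 <= (trace_form sigma a x / n%:R) ^+ n.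
Proof.
have := @leif_AGM R 'I_n predT (fun i => realval i * absval i x ^+ 2).
rewrite cardT size_enum_ord -trace_formE big_split prod_realval prodrXl prod_absval.
rewrite real_normK ?num_real // => -[] // i _.
exact: trace_term_ge0.
Qed.

Lemma powR_norm_le_trace_form x :
  (ratr (Nm a) * ratr (Nm x) ^+ 2) `^ n%:R^-1 * n%:R <= trace_form sigma a x.
Proof.
have n_gt0 : 0 < n%:R :> R by rewrite ltr0n dimK_gt0.
have T0 : 0 <= trace_form sigma a x / n%:R.
  rewrite divr_ge0 ?ler0n //; have [->|/trace_form_gt0/ltW //] := eqVneq x 0.
  by rewrite trace_form0.
have a0 : 0 <= ratr (Nm a) :> R := ltW Nm_totally_positive.
rewrite -ler_pdivlMr //.
have -> : trace_form sigma a x / n%:R = ((trace_form sigma a x / n%:R) ^+ n) `^ n%:R^-1.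
  by rewrite -powR_mulrn // -powRrM divff ?lt0r_neq0 // powRr1.
apply: ge0_ler_powR; last exact: norm_le_trace_form.
- by rewrite invr_ge0 ler0n.
- by rewrite nnegrE mulr_ge0 ?sqr_ge0.
- by rewrite nnegrE exprn_ge0.
Qed.

(** A single term of the form is at most [C], which bounds the square of [absval i x]; the
    inequality t <= 1 + t^2 then avoids a square root. *)
Lemma absval_le C i x : trace_form sigma a x <= C -> absval i x <= 1 + C / realval i.
Proof.
move=> TC; have m2 : absval i x ^+ 2 <= C / realval i.
  rewrite ler_pdivlMr ?realval_gt0 // mulrC; apply: le_trans TC.
  rewrite trace_formE (bigD1 i) //= lerDl; apply: sumr_ge0 => j _.
  exact: trace_term_ge0.
by have := sqr_ge0 (absval i x - 1); have := absval_ge0 i x; nra.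
Qed.

Lemma finite_trace_form_le C : finite_set [set x | OK x /\ trace_form sigma a x <= C].
Proof.
(* Each factor bounds the absolute value of [sigma i (k - x)] by the triangle inequality, as k <=
   [n]. *)
pose B := \prod_(i < n) (n%:R + (1 + C / realval i)).
apply: sub_finite_set (finite_Nm_bounded hK (Num.bound `|B|)) => x [Ox TC].
split=> // k.
rewrite -(ler_rat R) ratr_norm ratr_nat -prod_absval.
apply: le_trans (le_trans (ler_norm B) (ltW (archi_boundP (normr_ge0 B)))).
apply: ler_prod => i _; rewrite absval_ge0 -lecR -absvalE rmorphB rmorph_nat.
apply: le_trans (ler_normB _ _) _.
rewrite normr_nat absvalE -(rmorph_nat toC) -rmorphD lecR.
by apply: lerD (absval_le _ TC); rewrite ler_nat -ltnS.
Qed.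

(** Only nonzero integers whose form does not exceed its value at 1 compete for the minimum; they
    form a finite set containing 1. *)
Lemma mu_attained : exists x, [/\ OK x, x != 0, trace_form sigma a x = mu sigma a &
  forall y, OK y -> y != 0 -> mu sigma a <= trace_form sigma a y].
Proof.
pose S := [set x | OK x /\ trace_form sigma a x <= trace_form sigma a 1] `\ 0.
have finS : finite_set S by apply: finite_setD; exact: finite_trace_form_le.
have S1 : S 1.
  by split; [split; [exact: (integral1 intr)|] | apply/eqP; rewrite oner_neq0].
have [x [[Ox _] x0] x_min] :=
  finite_set_argmin (trace_form sigma a) finS (ex_intro _ _ S1).
have min_x y : OK y -> y != 0 -> trace_form sigma a x <= trace_form sigma a y.
  move=> Oy y0; have [y1|/ltW y1] := leP (trace_form sigma a y) (trace_form sigma a 1).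
    by apply: x_min; split; [|apply/eqP].
  exact: le_trans (x_min 1 S1) y1.
have muE : mu sigma a = trace_form sigma a x.
  apply: set_minE; first by exists x.
  by move=> _ [y [Oy /eqP y0] <-]; exact: min_x.
by exists x; split; rewrite ?muE //; apply/eqP.
Qed.

End TotallyPositive.

(** * Consequences of the bound on the Hermite-Humbert constant *)

Hypothesis hgamma : (hermite_humbert sigma <
  ((ratr (etaK K) `^ (2 / n%:R)) * n%:R)%:E)%E.

(** The quotient for [a] is below the supremum; clearing its denominator and merging the powers
    gives the shape of the AM-GM bound. *)
Lemma mu_lt a : 0 <= etaK K -> totally_positive sigma a ->
  mu sigma a < (ratr (Nm a) * ratr (etaK K) ^+ 2) `^ n%:R^-1 * n%:R.
Proof.
move=> eta0 a_pos.
have Nm_gt0 : 0 < ratr (Nm a) :> R := Nm_totally_positive a_pos.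
have : ((mu sigma a / (ratr (Nm a) `^ n%:R^-1))%:E <= hermite_humbert sigma)%E.
  by apply: ereal_sup_ubound; exists a.
move=> /le_lt_trans /(_ hgamma); rewrite lte_fin ltr_pdivrMr ?powR_gt0 //.
have eta0R : 0 <= ratr (etaK K) :> R by rewrite ler0q.
rewrite powRrM powR_mulrn // [in X in _ -> X]powRM ?sqr_ge0 ?(ltW Nm_gt0) //.
by rewrite mulrAC [X in X * _]mulrC.
Qed.

Lemma min_vectors_unit a : totally_positive sigma a ->
  min_vectors sigma a `<=` @integer_units K.
Proof.
move=> a_pos x [Ox Tx].
have [y [Oy y0 Ty _]] := mu_attained a_pos.
(* [min_vectors] does not exclude 0 by definition, but the form vanishes there while [mu] is
   positive, being attained at the nonzero [y]. *)
have x0 : x != 0.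
  apply: contraTneq (trace_form_gt0 a_pos y0) => x0.
  by rewrite Ty -Tx x0 trace_form0 // ltxx.
have [//|Sx] := integer_unit_or_nonunit hK Ox x0.
have /andP[eta0 etax] := etaK_le hK Sx.
have a0 : 0 <= ratr (Nm a) :> R := ltW (Nm_totally_positive a_pos).
have eta0R : 0 <= ratr (etaK K) :> R by rewrite ler0q.
have etaxR : ratr (etaK K) ^+ 2 <= ratr (Nm x) ^+ 2 :> R.
  by rewrite -[leRHS]real_normK ?num_real // -ratr_norm lerXn2r ?nnegrE ?ler0q ?ler_rat.
(* For a nonunit [x], AM-GM and [etaxR] give the reverse of this strict inequality. *)
have := mu_lt eta0 a_pos; rewrite ltNge -Tx => /negP[].
apply: le_trans (powR_norm_le_trace_form a_pos x).
rewrite ler_wpM2r ?ler0n //; apply: ge0_ler_powR.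
- by rewrite invr_ge0 ler0n.
- by rewrite nnegrE mulr_ge0 ?sqr_ge0.
- by rewrite nnegrE mulr_ge0 ?sqr_ge0.
- exact: ler_wpM2l.
Qed.

(** A minimizer over nonzero integers is a unit, hence also a minimizer over the smaller set of
    units. *)
Lemma mu_eq_mu_star a : totally_positive sigma a -> mu sigma a = mu_star sigma a.
Proof.
move=> a_pos; have [x [Ox x0 Tx x_min]] := mu_attained a_pos.
have Ux : integer_units x by apply: (min_vectors_unit a_pos).
apply/esym/set_minE; first by exists x.
move=> _ [u [Ou [v Ov uv]] <-]; apply: x_min => //.
by apply: contra_eq_neq uv => ->; rewrite mul0r eq_sym oner_neq0.
Qed.

End TraceForm.

Theorem theorem1 (R : realType) (K : splittingFieldType rat)
  (hK : galois 1%VS {:K})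
  (sigma : 'I_(\dim {:K}) -> {rmorphism K -> R[i]})
  (hsigma : enumerates_embeddings sigma)
  (hgamma : (hermite_humbert sigma <
     ((ratr (etaK K) `^ (2 / (\dim {:K})%:R)) * (\dim {:K})%:R)%:E)%E) :
  strongly_unit_reducible sigma.
Proof.
by split=> a; [exact: mu_eq_mu_star | exact: min_vectors_unit].
Qed.
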